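(* Let $0<\alpha<1$, and let $\lambda_k=k^{\alpha}$ for $k\ge 1$ and $\Lambda_n=\sum_{k=1}^n k^{\alpha}$ for $n\ge 1$. Then for every sequence $(a_n)_{n\ge 1}$ of non-negative real numbers such that $\sum_{n=1}^\infty a_n$ converges, $$\sum_{n=1}^\infty G_n\le e^{1/(\alpha+1)}\sum_{n=1}^\infty a_n,\qquad\text{where } G_n=\prod_{k=1}^n a_k^{\lambda_k/\Lambda_n}.$$
   Context: Since all terms are non-negative, the infinite sum $\sum_n G_n$ is understood as an element of $[0,+\infty]$. *)

(* Defs.v *)
From mathcomp Require Import all_boot all_order all_algebra.
From mathcomp Require Import all_classical all_reals all_analysis.
Set Implicit Arguments.
Unset Strict Implicit.
Unset Printing Implicit Defensive.
Import Order.TTheory GRing.Theory Num.Theory.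
Import numFieldNormedType.Exports.
Local Open Scope classical_set_scope.
Local Open Scope ring_scope.

(* Sequences are indexed from 1: the value at 0 of a sequence is never used. *)

Definition weight (R : realType) (alpha : R) (k : nat) : R := k%:R `^ alpha.

Definition weight_sum (R : realType) (alpha : R) (n : nat) : R :=
  \sum_(1 <= k < n.+1) weight alpha k.

(* For n >= 1 all exponents are positive, and [0 `^ x = 0] for x <> 0, so
   this is 0 as soon as one of a_1, ..., a_n is 0. *)
Definition weighted_gmean (R : realType) (alpha : R) (a : R^nat) (n : nat) : R :=
  \prod_(1 <= k < n.+1) a k `^ (weight alpha k / weight_sum alpha n).

(* Main.v *)
Require Import Defs.
From mathcomp Require Import all_boot all_order all_algebra.
From mathcomp Require Import all_classical all_reals all_analysis.
From mathcomp Require Import ring lra.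
Import Order.TTheory GRing.Theory Num.Theory.
Import numFieldNormedType.Exports.
Local Open Scope classical_set_scope.
Local Open Scope ring_scope.

(** The proof follows Polya's treatment of Carleman's inequality, in Love's
weighted form. Write [X n] for the ratio [Lambda_n / lambda_n].

For any positive weights, put [c k = X k * (X k.+1 / X k) `^ X k]. This choice
makes the weighted geometric mean of [c 1, ..., c n] equal to [X n.+1], so that
the weighted AM-GM inequality applied to the numbers [c k * a k] gives
[G n <= S n * (1 / Lambda_n - 1 / Lambda_n.+1)], where [S n] is the sum of the
[lambda_k * c k * a k] for [k <= n] ([gmean_le_telescope]). Summation by parts
turns this into a bound of the sum of the [G n] by the sum of the
[(lambda_k * c k / Lambda_k) * a k], whose coefficients are
[(X k.+1 / X k) `^ X k]. Hence the constant [expR M] is admissible as soon as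
[X k * ln (X k.+1 / X k) <= M] for all [k] ([Carleman_weighted]).

For the weights [k `^ p] with [0 < p < 1], the criterion holds with
[M = 1 / (p + 1)] ([power_weight_criterion]). The cruder sufficient condition
[X k.+1 - X k <= M], obtained from [ln (1 + z) <= z], fails at [k = 1], where
the left side is [2 `^ (- p)]; the logarithm therefore has to be kept. Since
[X n.+1 = 1 + X n * (1 + 1 / n) `^ (- p)], with [y = 1 / ((p + 1) * X n)] the
criterion reads [(1 + 1 / n) `^ (- p) + (p + 1) * y <= expR y]. The Levin-Steckin
lower bound on [Lambda_n] says that [y <= (1 + 1 / n) `^ (- p) / n], and on that
range the inequality follows from the second order expansion of [expR]
together with Bernoulli's inequality for real exponents
([expR_powR_estimate]). *)

(** * Elementary inequalities *)

Lemma expR_ge_quadratic (R : realType) (x : R) :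
  0 <= x -> 1 + x + x ^+ 2 / 2 <= expR x.
Proof.
move=> x0.
have nd : nondecreasing_seq (series (exp_coeff x)).
  by apply: nondecreasing_series => n _ _; rewrite exp_coeff_ge0.
have := nondecreasing_cvgn_le nd (is_cvg_series_exp_coeff x) 3%N.
rewrite /series/= !big_nat_recr//= big_geq// /exp_coeff/=.
by rewrite expr0 fact0 divr1 expr1 divr1 add0r.
Qed.

(** Polya's proof: with [A] the arithmetic mean, the product of the inequalities
[b i / A <= expR (b i / A - 1)] raised to the powers [w i] has right-hand side
[1], because the weighted mean of the exponents is [0]. *)
Lemma weighted_AMGM (R : realType) (I : eqType) (r : seq I) (w b : I -> R) :
  (forall i, i \in r -> 0 <= w i) -> (forall i, i \in r -> 0 <= b i) ->
  \sum_(i <- r) w i = 1 ->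
  \prod_(i <- r) b i `^ w i <= \sum_(i <- r) w i * b i.
Proof.
move=> w0 b0 w1; set A := \sum_(i <- r) w i * b i.
have wb0 i : i \in r -> 0 <= w i * b i by move=> ir; rewrite mulr_ge0 ?w0 ?b0.
have A0 : 0 <= A by rewrite /A big_seq sumr_ge0.
have [A_eq0|A_neq0] := eqVneq A 0.
  rewrite A_eq0 le_eqVlt prodf_seq_eq0; apply/orP; left.
  have /hasP[i ir wi0] : has (fun i => w i != 0) r.
    apply: contraT => /hasPn wr; move: w1; rewrite big_seq big1 => [/eqP|i ir].
      by rewrite eq_sym oner_eq0.
    by apply/eqP; have := wr _ ir; rewrite negbK.
  apply/hasP; exists i => //=; rewrite powR_eq0 wi0 andbT.
  have : \sum_(j <- r | j \in r) w j * b j == 0 by rewrite -big_seq -/A A_eq0.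
  rewrite psumr_eq0//= => /allP/(_ _ ir).
  by rewrite ir /= mulf_eq0 (negbTE wi0).
have A_gt0 : 0 < A by rewrite lt_def A_neq0.
(* [z <= expR (z - 1)] at [z = b i / A]; the factor [A] enters as [expR (ln A)]
   so that the whole product collapses into one exponential. *)
have tangent i : i \in r -> b i `^ w i <= expR ((ln A + (b i / A - 1)) * w i).
  move=> ir; rewrite expRM ge0_ler_powR ?w0// ?nnegrE ?b0 ?expR_ge0//.
  rewrite expRD lnK ?posrE// mulrC -ler_pdivrMr//.
  by rewrite -{1}(subrK 1 (b i / A)) addrC expR_ge1Dx.
apply: (@le_trans _ _ (\prod_(i <- r) expR ((ln A + (b i / A - 1)) * w i))).
  by rewrite big_seq [leRHS]big_seq ler_prod// => i ir; rewrite powR_ge0 tangent.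
rewrite -expR_sum.
rewrite (eq_bigr (fun i => (ln A - 1) * w i + A^-1 * (w i * b i))); last first.
  by move=> i _; ring.
rewrite big_split/= -!mulr_sumr w1 -/A mulVf// mulr1 subrK.
by rewrite lnK ?posrE.
Qed.

(** AM-GM for the two numbers [1 + h] and [1] with weights [p] and [1 - p]. *)
Lemma Bernoulli_powR (R : realType) (p h : R) :
  0 <= p <= 1 -> 0 <= h -> (1 + h) `^ p <= 1 + p * h.
Proof.
move=> /andP[p0 p1] h0.
have := @weighted_AMGM _ bool [:: true; false]
  (fun i => if i then p else 1 - p) (fun i => if i then 1 + h else 1).
rewrite !big_cons !big_nil /= powR1 !mulr1 addr0 => /(_ _ _ _).
have -> : p * (1 + h) + (1 - p) = 1 + p * h by ring.
apply.
- by case=> _; rewrite ?subr_ge0.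
- by case=> _; rewrite ?addr_ge0.
- by ring.
Qed.

(** Bernoulli's inequality for the complementary exponent [1 - p] gives a lower
bound on the power [p]; it is stated without division. *)
Lemma reverse_Bernoulli_powR (R : realType) (p h : R) :
  0 <= p <= 1 -> 0 <= h -> 1 + h <= (1 + h) `^ p * (1 + (1 - p) * h).
Proof.
move=> /andP[p0 p1] h0.
have h1 : 0 < 1 + h by lra.
have split_h : (1 + h) `^ p * (1 + h) `^ (1 - p) = 1 + h.
  rewrite -powRD; last by apply/implyP => _; rewrite gt_eqF.
  by rewrite (addrC p) subrK powRr1 ?ltW.
rewrite -[leLHS]split_h.
rewrite ler_wpM2l ?powR_ge0// Bernoulli_powR//; lra.
Qed.

(** * Carleman's inequality with general weights *)

Definition partial_sum {R : realType} (lam : R^nat) (n : nat) : R :=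
  \sum_(1 <= k < n.+1) lam k.

Definition sum_ratio {R : realType} (lam : R^nat) (n : nat) : R :=
  partial_sum lam n / lam n.

(** Logarithm of the factor [X k * (X k.+1 / X k) `^ X k], with [X] the ratio
above, by which [a k] is multiplied before AM-GM is applied. *)
Definition ln_polya_factor {R : realType} (lam : R^nat) (k : nat) : R :=
  ln (sum_ratio lam k) +
  sum_ratio lam k * (ln (sum_ratio lam k.+1) - ln (sum_ratio lam k)).

Lemma partial_sumS (R : realType) (lam : R^nat) n :
  partial_sum lam n.+1 = partial_sum lam n + lam n.+1.
Proof. by rewrite /partial_sum big_nat_recr. Qed.

Lemma partial_sum_gt0 (R : realType) (lam : R^nat) n :
  (forall k, (0 < k)%N -> 0 < lam k) -> (0 < n)%N -> 0 < partial_sum lam n.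
Proof.
move=> lam0; case: n => // n _; rewrite partial_sumS ltr_wpDl ?lam0//.
by rewrite /partial_sum big_nat_cond sumr_ge0// => k; rewrite andbT => /andP[k0 _];
  rewrite ltW ?lam0.
Qed.

(** The factors are designed for this identity: since
[lam k * X k = partial_sum lam k], the [k]-th term is
[partial_sum lam k * ln (X k.+1) - partial_sum lam k.-1 * ln (X k)] and the sum
telescopes. It says that the weighted geometric mean of the factors is
[X n.+1]. *)
Lemma sum_weight_ln_polya_factor (R : realType) (lam : R^nat) n :
  (forall k, (0 < k)%N -> 0 < lam k) ->
  \sum_(1 <= k < n.+1) lam k * ln_polya_factor lam k =
  partial_sum lam n * ln (sum_ratio lam n.+1).
Proof.
move=> lam0; elim: n => [|n IH].
  by rewrite /partial_sum !big_geq// mul0r.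
rewrite big_nat_recr//= IH /ln_polya_factor mulrDr mulrA.
have -> : lam n.+1 * sum_ratio lam n.+1 = partial_sum lam n.+1.
  by rewrite /sum_ratio mulrC divfK// gt_eqF ?lam0.
by rewrite partial_sumS; ring.
Qed.

(** AM-GM for the numbers [c k * a k], [c k] being the factor whose logarithm
is [ln_polya_factor lam k]. The geometric mean of the [c k] is
[partial_sum lam n.+1 / lam n.+1], and dividing by it turns the
[1 / partial_sum lam n] of the arithmetic mean into a difference of consecutive
reciprocals. *)
Lemma gmean_le_telescope (R : realType) (lam a : R^nat) n :
  (forall k, (0 < k)%N -> 0 < lam k) -> (forall k, (0 < k)%N -> 0 <= a k) ->
  (0 < n)%N ->
  \prod_(1 <= k < n.+1) a k `^ (lam k / partial_sum lam n) <=
  (\sum_(1 <= k < n.+1) lam k * (expR (ln_polya_factor lam k) * a k)) *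
  ((partial_sum lam n)^-1 - (partial_sum lam n.+1)^-1).
Proof.
move=> lam0 a0 n0.
have L0 := @partial_sum_gt0 _ _ _ lam0 n0.
have L'0 := @partial_sum_gt0 _ _ n.+1 lam0 isT.
have l0 : 0 < lam n.+1 by rewrite lam0.
set L := partial_sum lam n in L0 *.
pose c k := expR (ln_polya_factor lam k).
have k_gt0 k : k \in index_iota 1 n.+1 -> (0 < k)%N.
  by rewrite mem_index_iota => /andP[].
have amgm : \prod_(1 <= k < n.+1) (c k * a k) `^ (lam k / L) <=
            \sum_(1 <= k < n.+1) lam k / L * (c k * a k).
  apply: weighted_AMGM => [k /k_gt0 k0|k /k_gt0 k0|].
  - by rewrite divr_ge0 ?ltW ?lam0.
  - by rewrite mulr_ge0 ?expR_ge0 ?a0.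
  - by rewrite -mulr_suml -/(partial_sum lam n) divff// gt_eqF.
have prod_c : \prod_(1 <= k < n.+1) (c k * a k) `^ (lam k / L) =
    sum_ratio lam n.+1 * \prod_(1 <= k < n.+1) a k `^ (lam k / L).
  rewrite (eq_big_seq (fun k => expR (lam k * ln_polya_factor lam k / L) *
                              a k `^ (lam k / L))); last first.
    move=> k /k_gt0 k0; rewrite powRM ?expR_ge0 ?a0// -expRM.
    by congr (expR _ * _); ring.
  rewrite big_split/= -expR_sum -mulr_suml sum_weight_ln_polya_factor//.
  rewrite -/L mulrAC divff ?gt_eqF// mul1r lnK// posrE.
  by rewrite /sum_ratio divr_gt0.
have X0 : 0 < sum_ratio lam n.+1 by rewrite /sum_ratio divr_gt0.
rewrite -(ler_pM2l X0) -prod_c (le_trans amgm)// le_eqVlt; apply/orP; left.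
rewrite (eq_bigr (fun k => lam k * (c k * a k) * L^-1)); last first.
  by move=> k _; rewrite /c; ring.
rewrite -mulr_suml mulrCA; apply/eqP; congr (_ * _).
rewrite /sum_ratio partial_sumS -/L; field.
by rewrite !gt_eqF// addr_gt0.
Qed.

(** Summation by parts. It is carried out by adding the boundary term
[S N / partial_sum lam N.+1] to the left side, which makes the inequality
provable by induction on [N]: one step adds the single term
[lam k * c k / partial_sum lam k * a k] with [k = N.+1], whose coefficient
is at most [expR M] by hypothesis. *)
Lemma Carleman_partial (R : realType) (lam a : R^nat) (M : R) N :
  (forall k, (0 < k)%N -> 0 < lam k) -> (forall k, (0 < k)%N -> 0 <= a k) ->
  (forall k, (0 < k)%N -> sum_ratio lam k *
     (ln (sum_ratio lam k.+1) - ln (sum_ratio lam k)) <= M) ->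
  \sum_(1 <= n < N.+1) \prod_(1 <= k < n.+1) a k `^ (lam k / partial_sum lam n)
    <= expR M * \sum_(1 <= n < N.+1) a n.
Proof.
move=> lam0 a0 XM.
pose S n := \sum_(1 <= k < n.+1) lam k * (expR (ln_polya_factor lam k) * a k).
have S0 n : 0 <= S n.
  rewrite /S big_nat_cond sumr_ge0// => k; rewrite andbT => /andP[k0 _].
  by rewrite mulr_ge0 ?mulr_ge0 ?expR_ge0 ?a0// ltW ?lam0.
suff : \sum_(1 <= n < N.+1) \prod_(1 <= k < n.+1)
    a k `^ (lam k / partial_sum lam n) + S N / partial_sum lam N.+1
    <= expR M * \sum_(1 <= n < N.+1) a n.
  by apply: le_trans; rewrite lerDl divr_ge0// ltW// partial_sum_gt0.
elim: N => [|N IH]; first by rewrite /S !big_geq// mul0r mulr0 addr0.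
rewrite big_nat_recr//= [in leRHS]big_nat_recr//= [leRHS]mulrDr.
have G := @gmean_le_telescope _ lam a N.+1 lam0 a0 isT.
rewrite -/(S N.+1) in G.
have l0 : 0 < lam N.+1 by rewrite lam0.
have L0 := @partial_sum_gt0 _ _ N.+1 lam0 isT.
have SS : S N.+1 / partial_sum lam N.+1 <=
          S N / partial_sum lam N.+1 + expR M * a N.+1.
  rewrite /S big_nat_recr//= mulrDl lerD2l.
  have X0 : 0 < sum_ratio lam N.+1 by rewrite /sum_ratio divr_gt0.
  rewrite /ln_polya_factor expRD lnK ?posrE//.
  rewrite {1}/sum_ratio.
  set e := expR _.
  have -> : lam N.+1 * (partial_sum lam N.+1 / lam N.+1 * e * a N.+1) /
     partial_sum lam N.+1 = e * a N.+1 by field; rewrite !gt_eqF.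
  by rewrite ler_wpM2r ?a0// /e ler_expR XM.
lra.
Qed.

Lemma Carleman_weighted (R : realType) (lam a : R^nat) (M : R) :
  (forall k, (0 < k)%N -> 0 < lam k) -> (forall k, (0 < k)%N -> 0 <= a k) ->
  (forall k, (0 < k)%N -> sum_ratio lam k *
     (ln (sum_ratio lam k.+1) - ln (sum_ratio lam k)) <= M) ->
  (\sum_(1 <= n <oo)
     (\prod_(1 <= k < n.+1) a k `^ (lam k / partial_sum lam n))%:E
    <= (expR M)%:E * \sum_(1 <= n <oo) (a n)%:E)%E.
Proof.
move=> lam0 a0 XM.
apply: lime_le.
  apply: is_cvg_nneseries => n _ _; rewrite lee_fin big_seq prodr_ge0// => k _.
  exact: powR_ge0.
apply: nearW => -[|N].
  rewrite big_geq// mule_ge0 ?lee_fin ?expR_ge0//.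
  by apply: nneseries_ge0 => n n0 _; rewrite lee_fin a0.
rewrite sumEFin; apply: (@le_trans _ _ (expR M * \sum_(1 <= n < N.+1) a n)%:E).
  by rewrite lee_fin Carleman_partial.
rewrite EFinM lee_wpmul2l ?lee_fin ?expR_ge0// -sumEFin.
by apply: nneseries_lim_ge => n n0 _; rewrite lee_fin a0.
Qed.

(** * The weights [k `^ p] *)

Lemma weight_gt0 (R : realType) (p : R) k : (0 < k)%N -> 0 < weight p k.
Proof. by move=> k0; rewrite /weight powR_gt0// ltr0n. Qed.

(** By induction on [n]: the step amounts to
[(1 + 1 / n.+1) `^ p <= 1 + p / n.+1]. *)
Lemma Levin_Steckin (R : realType) (p : R) n : 0 <= p <= 1 ->
  n%:R * weight p n.+1 <= (p + 1) * weight_sum p n.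
Proof.
move=> /andP[p0 p1]; elim: n => [|n IH].
  by rewrite mul0r /weight_sum big_geq// mulr0.
rewrite /weight_sum big_nat_recr//= -/(weight_sum p n) mulrDr.
apply: le_trans (lerD IH (lexx _)).
have n0 : 0 < n.+1%:R :> R by rewrite ltr0n.
have -> : weight p n.+2 = weight p n.+1 * (1 + n.+1%:R^-1) `^ p.
  rewrite /weight -powRM ?ler0n ?addr_ge0 ?invr_ge0//.
  by congr (_ `^ _); rewrite mulrDr mulr1 divff ?gt_eqF// natr1.
have B : (1 + n.+1%:R^-1) `^ p <= 1 + p * n.+1%:R^-1.
  by rewrite Bernoulli_powR ?p0 ?p1 ?invr_ge0.
apply: (@le_trans _ _ (n.+1%:R * (weight p n.+1 * (1 + p * n.+1%:R^-1)))).
  by rewrite ler_wpM2l// ler_wpM2l// ltW// weight_gt0.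
rewrite le_eqVlt; apply/orP; left; apply/eqP.
have -> : n%:R = n.+1%:R - 1 :> R by rewrite -natr1 addrK.
by field; rewrite gt_eqF.
Qed.

(** Write [r = (1 + h) `^ (- p)]. As [expR y >= 1 + y + y ^+ 2 / 2], it suffices
that [r <= 1 - p * y + y ^+ 2 / 2] for [0 <= y <= r * h]. This quadratic in [y]
has its minimum at [y = p]. If [r * h <= p] it is decreasing on the range, and
the bound is needed at [y = r * h] only; otherwise its minimum
[1 - p ^+ 2 / 2] is already at least [r]. Both bounds come from the two
Bernoulli inequalities for [(1 + h) `^ p]. *)
Lemma expR_powR_estimate (R : realType) (p h y : R) :
  0 < p < 1 -> 0 < h <= 1 -> 0 <= y -> y * (1 + h) `^ p <= h ->
  ((1 + h) `^ p)^-1 + (p + 1) * y <= expR y.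
Proof.
move=> /andP[p0 p1] /andP[h0 h1] y0.
have /= := @Bernoulli_powR R p h; have /= := @reverse_Bernoulli_powR R p h.
have P0 : 0 < (1 + h) `^ p by rewrite powR_gt0//; lra.
rewrite (ltW p0) (ltW p1) (ltW h0); set P := (1 + h) `^ p in P0 *.
move=> /(_ isT isT) rB /(_ isT isT) B yP.
apply: le_trans (expR_ge_quadratic _ _ y0).
set r := P^-1.
have r0 : 0 < r by rewrite invr_gt0.
have rP : r * P = 1 by rewrite mulVf ?gt_eqF.
have yr : y <= r * h by rewrite -(ler_pM2r P0) mulrAC rP mul1r.
suff : r <= 1 - p * y + y ^+ 2 / 2 by lra.
have r_le1 : r <= 1.
  have : 1 <= P by rewrite -(powRr0 (1 + h)) ler_powR ?ltW//; lra.
  nra.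
have [prh|rhp] := leP (r * h) p.
  (* The quadratic term contributes [r * h ^+ 2 / 2 >= h ^+ 2 / 4], which is
     what the lower bound on [P] loses. *)
  have half_r : 1 / 2 <= r.
    have P2 : P <= 2 by nra.
    by rewrite -(ler_pM2r P0) rP; lra.
  have lower_P : 1 + p * h - h ^+ 2 / 4 <= P.
    have D0 : 0 < 1 + (1 - p) * h by nra.
    rewrite -(ler_pM2r D0); apply: le_trans rB.
    have : 0 <= (1 - p) * h ^+ 3 by rewrite mulr_ge0 ?exprn_ge0 ?ltW ?subr_gt0.
    (* [p * (1 - p) <= 1 / 4], multiplied by [h ^+ 2] *)
    have := mulr_ge0 (sqr_ge0 h) (sqr_ge0 (p - 1 / 2)).
    lra.
  have at_rh : r <= 1 - p * (r * h) + (r * h) ^+ 2 / 2.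
    have : 1 <= P - p * h + r * h ^+ 2 / 2.
      have : 1 / 2 * h ^+ 2 <= r * h ^+ 2 by rewrite ler_wpM2r ?sqr_ge0.
      lra.
    rewrite -(ler_pM2l r0) mulr1 => /le_trans; apply.
    by rewrite mulrDr mulrBr rP le_eqVlt; apply/orP; left; apply/eqP; ring.
  apply: (le_trans at_rh).
  have : 0 <= (r * h - y) * (p - (y + r * h) / 2) by apply: mulr_ge0; lra.
  lra.
have ph : p < h by nra.
have at_p : r <= 1 - p ^+ 2 / 2.
  have one_h : 0 < 1 + h by lra.
  rewrite -(ler_pM2r one_h).
  have : r * (1 + h) <= 1 + (1 - p) * h.
    by rewrite -(ler_pM2r P0) mulrAC rP mul1r mulrC.
  move=> /le_trans; apply.
  nra.
(* The quadratic exceeds its minimum by [(y - p) ^+ 2 / 2]. *)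
apply: (le_trans at_p); have := sqr_ge0 (y - p); lra.
Qed.

(** Exponentiating the criterion reduces it to [expR_powR_estimate] with
[h = 1 / n] and [y = 1 / ((p + 1) * X n)]; the hypothesis on [y] there is the
Levin-Steckin inequality. *)
Lemma power_weight_criterion (R : realType) (p : R) n :
  0 < p < 1 -> (0 < n)%N ->
  sum_ratio (weight p) n *
    (ln (sum_ratio (weight p) n.+1) - ln (sum_ratio (weight p) n))
  <= 1 / (p + 1).
Proof.
move=> p01 n0; have /andP[p0 p1] := p01.
have w0 k : (0 < k)%N -> 0 < weight p k by exact: weight_gt0.
have L0 := @partial_sum_gt0 _ _ _ w0 n0.
have wn0 := w0 _ n0.
have nR0 : 0 < n%:R :> R by rewrite ltr0n.
set X := sum_ratio _ n.
have X0 : 0 < X by rewrite divr_gt0.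
pose h : R := n%:R^-1; pose P := (1 + h) `^ p.
have h0 : 0 < h by rewrite invr_gt0.
have h1 : h <= 1 by rewrite invf_le1// ler1n.
have P0 : 0 < P by rewrite powR_gt0// addr_gt0.
have wS : weight p n.+1 = weight p n * P.
  rewrite /weight /P -powRM ?ler0n ?addr_ge0 ?(ltW h0)//.
  by congr (_ `^ _); rewrite mulrDr mulr1 divff ?gt_eqF// natr1.
have XS : sum_ratio (weight p) n.+1 = X * P^-1 + 1.
  rewrite /X /sum_ratio partial_sumS wS; field.
  by rewrite !gt_eqF.
have q0 : 0 < p + 1 by rewrite addr_gt0.
pose y := ((p + 1) * X)^-1.
have y0 : 0 < y by rewrite invr_gt0 mulr_gt0.
have yP : y * P <= h.
  have := @Levin_Steckin _ p n; rewrite (ltW p0) (ltW p1) => /(_ isT).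
  rewrite wS -[weight_sum p n]/(partial_sum (weight p) n) => LS.
  rewrite /y [leLHS]mulrC ler_pdivrMr; last exact: mulr_gt0.
  rewrite [leRHS]mulrC ler_pdivlMr// /X /sum_ratio mulrA ler_pdivlMr//.
  lra.
rewrite XS -ln_div ?posrE ?addr_gt0 ?divr_gt0//.
have -> : (X / P + 1) / X = P^-1 + (p + 1) * y.
  by rewrite /y; field; rewrite !gt_eqF.
have -> : 1 / (p + 1) = X * y by rewrite /y; field; rewrite !gt_eqF.
rewrite ler_pM2l// -ler_expR lnK ?posrE ?addr_gt0 ?invr_gt0 ?mulr_gt0//.
by apply: (@expR_powR_estimate _ p h) => //; [rewrite h0 h1|exact: ltW].
Qed.

Theorem theorem3p1 (R : realType) (alpha : R) (alpha_gt0 : 0 < alpha)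
    (alpha_lt1 : alpha < 1) (a : R^nat)
    (a_ge0 : forall n, (1 <= n)%N -> 0 <= a n)
    (a_cvg : cvgn (fun n => \sum_(1 <= k < n) a k)) :
  (\sum_(1 <= n <oo) (weighted_gmean alpha a n)%:E
     <= (expR (1 / (alpha + 1)))%:E * \sum_(1 <= n <oo) (a n)%:E)%E.
Proof.
apply: (@Carleman_weighted _ (weight alpha)) => // k k0.
  exact: weight_gt0.
by apply: power_weight_criterion; rewrite ?alpha_gt0.
Qed.
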